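(* There exist absolute constants $c>0$ (sufficiently small) and $C>0$ (sufficiently large) such that the following holds. Let $\epsilon\in(0,c)$ and $\overline\rho\in(0,\sqrt\epsilon)$. Let $S_0=\{x_1,\dots,x_n\}\subset\mathbb R^d$ be $(\epsilon,\gamma)$-PCA-stable with respect to a positive definite matrix $\vec\Sigma\in\mathbb R^{d\times d}$. Let $T$ be any multiset with $T\in\mathcal O(S,\epsilon)$ for some $S\in\mathcal W^{\mathrm{strong}}(S_0,\overline\rho,\vec\Sigma)$. Then any stability-based PCA algorithm, on input $T$, $\epsilon$ and $\tilde\gamma=C(\gamma+\overline\rho^2/\epsilon)$, outputs a unit vector $v$ such that, with high probability over its internal randomness, $v^\top\vec\Sigma v\ge\big(1-O(\gamma+\overline\rho^2/\epsilon)\big)\|\vec\Sigma\|_{\mathrm{op}}$.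
   Context: For $0<\epsilon\le\gamma$, a finite multiset $S$ is $(\epsilon,\gamma)$-PCA-stable w.r.t. a PSD matrix $\vec\Sigma$ if for every $S'\subseteq S$ with $|S'|\ge(1-\epsilon)|S|$: $(1-\gamma)\vec\Sigma\preceq\frac1{|S'|}\sum_{x\in S'}xx^\top\preceq(1+\gamma)\vec\Sigma$. $\mathcal O(S,\epsilon)$ is the set of $n$-point multisets $S'$ with $|S'\cap S|\ge(1-\epsilon)n$. $\mathcal W^{\mathrm{strong}}(S_0,\overline\rho,\vec\Sigma)$ is the set of multisets $\{\tilde x_1,\dots,\tilde x_n\}$ (in any order) with $\sup_{\|v\|_2=1}\frac1n\sum_i|v^\top\vec\Sigma^{-1/2}(\tilde x_i-x_i)|\le\overline\rho$. A stability-based PCA algorithm is a polynomial-time algorithm taking $T,\epsilon,\gamma$ and, whenever $S$ is $(\epsilon,\gamma)$-PCA-stable w.r.t. an unknown PSD $\vec\Sigma$ and $T\in\mathcal O(S,\epsilon)$, outputs a unit vector $v$ with $v^\top\vec\Sigma v\ge(1-O(\gamma))\|\vec\Sigma\|_{\mathrm{op}}$ (with high probability).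
   Formalization: The formal theorem assumes in addition $\epsilon n\ge 1$ and runs the algorithm on input $T$, $2\epsilon$ (instead of $\epsilon$) and $\tilde\gamma$; the claim as stated fails if $\epsilon n<1$, and can fail when the algorithm is given exactly $\epsilon$. *)

(* Defs.v *)
From HB Require Import structures.
From mathcomp Require Import all_boot all_order all_algebra.
From mathcomp Require Import finmap multiset.
From mathcomp Require Import all_classical all_reals all_analysis.

Set Implicit Arguments.
Unset Strict Implicit.
Unset Printing Implicit Defensive.

Import Order.TTheory GRing.Theory Num.Theory.
Import numFieldNormedType.Exports.

Local Open Scope mset_scope.
Local Open Scope classical_set_scope.
Local Open Scope ring_scope.

Section LinearAlgebra.
Context {R : realType} {d : nat}.
Implicit Types (u v x : 'cV[R]_d) (A B M : 'M[R]_d).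

Definition dotv u v : R := (u^T *m v) 0 0.

(* Euclidean norm: the library norm `|v| on matrices is the max norm. *)
Definition norm2 v : R := Num.sqrt (dotv v v).

Definition unit_vec : set 'cV[R]_d := [set v | norm2 v = 1].

Definition quad A v : R := dotv v (A *m v).

Definition psd A : Prop := A^T = A /\ forall v, 0 <= quad A v.

Definition posdef A : Prop := A^T = A /\ forall v, v != 0 -> 0 < quad A v.

Definition loewner_le A B : Prop := psd (B - A).

(* For 0 < d this is the supremum of a nonempty bounded set. *)
Definition op_norm A : R := sup [set norm2 (A *m v) | v in unit_vec].

(* M = A^{-1/2}: for A positive definite, the unique PSD square root of
   A^{-1}. *)
Definition is_invsqrt A M : Prop := psd M /\ M *m M = invmx A.

End LinearAlgebra.

Section Contamination.
Context {R : realType} {d : nat}.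
Implicit Types (S T : {mset 'cV[R]_d}) (Sigma : 'M[R]_d).

Definition second_moment S : 'M[R]_d :=
  (size S)%:R^-1 *: \sum_(x <- S) (x *m x^T).

Definition pca_stable S (eps gamma : R) Sigma : Prop :=
  [/\ 0 < eps <= gamma,
      psd Sigma
    & forall S', msubset S' S -> (1 - eps) * (size S)%:R <= (size S')%:R ->
        loewner_le ((1 - gamma) *: Sigma) (second_moment S') /\
        loewner_le (second_moment S') ((1 + gamma) *: Sigma)].

Definition outlier_corruptions S (eps : R) : set {mset 'cV[R]_d} :=
  [set T : {mset 'cV[R]_d} | size T = size S /\
           (1 - eps) * (size S)%:R <= (size (msetI T S))%:R].

Definition strong_perturbations S0 (rho : R) Sigma : set {mset 'cV[R]_d} :=
  [set S | exists (n : nat) (x xt : 'I_n -> 'cV[R]_d) (M : 'M[R]_d),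
    [/\ S0 = seq_mset (codom x),
        S = seq_mset (codom xt),
        is_invsqrt Sigma M
      & (ereal_sup
           [set (n%:R^-1 * \sum_(i < n) `|dotv v (M *m (xt i - x i))|)%:E
             | v in unit_vec] <= rho%:E)%E]].

End Contamination.

(* The arguments of the output function are the dimension, the sample, the
   contamination and stability parameters, and the internal randomness. *)
Record randomized_pca (R : realType) (disp : measure_display)
    (Omega : measurableType disp) := RandomizedPCA {
  pca_output :> forall d : nat,
    {mset 'cV[R]_d} -> R -> R -> Omega -> 'cV[R]_d;
  pca_output_measurable : forall (d : nat) (T : {mset 'cV[R]_d})
    (eps gamma : R) (i : 'I_d),
    measurable_fun setT (fun w => pca_output T eps gamma w i 0) }.

(* K is the constant hidden in the O(gamma) of the guarantee;
   delta d n eps gamma is the failure probability on n points of R^d. *)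
Definition stability_based_pca (R : realType) (disp : measure_display)
    (Omega : measurableType disp) (P : probability Omega R)
    (A : randomized_pca R Omega) (K : R) (delta : nat -> nat -> R -> R -> R)
    : Prop :=
  forall (d : nat) (S T : {mset 'cV[R]_d}) (eps gamma : R) (Sigma : 'M[R]_d),
    (0 < d)%N ->
    pca_stable S eps gamma Sigma ->
    outlier_corruptions S eps T ->
    (forall w, unit_vec (A d T eps gamma w)) /\
    ((1 - delta d (size T) eps gamma)%:E <=
       P [set w | ((1 - K * gamma) * op_norm Sigma
                   <= quad Sigma (A d T eps gamma w))%R])%E.

(* Main.v *)
(** Let [D i = xt i - x i] be the perturbations.  Among finite families [l] of vectors with
    [\sum_(b <- l) quad Sigma b <= 1], take a near-maximiser of
    [\sum_i sqrt (\sum_(b <- l) (b . D i)^2)]; Khintchine's inequality bounds this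
    sum by [2 n rho].  Discard the at most [eps n] indices whose summand exceeds
    [2 rho / eps].  Perturbing [l] by a single vector [u] and using near-optimality
    shows that the remaining [D i] satisfy
    [\sum_i (u . D i)^2 <= 18 n (rho^2 / eps) quad Sigma u] (a form of the little
    Grothendieck inequality).  Undoing the discarded perturbations gives a set which
    agrees with [T] up to [2 eps n] points.  It is stable: Cauchy-Schwarz alone would
    only bound the cross terms by [rho / sqrt eps], but the few points with
    [(u . x i)^2 > 6 gamma quad Sigma u / eps] carry mass [O(gamma)] by stability of
    [S0], and on the other points the [l1] bound on [u . D i] together with AM-GM
    gives [O(gamma + rho^2 / eps)].  The guarantee of the algorithm then applies to
    this set, with the same [Sigma]. *)

Require Import Defs.
From HB Require Import structures.
From mathcomp Require Import all_boot all_order all_algebra.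
From mathcomp Require Import finmap multiset.
From mathcomp Require Import all_classical all_reals all_analysis.
From mathcomp Require Import ring lra zify.
Import Order.TTheory GRing.Theory Num.Theory.
Import numFieldNormedType.Exports.
Local Open Scope mset_scope.
Local Open Scope classical_set_scope.
Local Open Scope ring_scope.

(** * Bilinearity of the dot product and the parallelogram law *)

Section DotProduct.
Context {R : realType} {d : nat}.
Implicit Types u v w x : 'cV[R]_d.

Lemma dotvZl (c : R) u v : dotv (c *: u) v = c * dotv u v.
Proof. by rewrite /dotv linearZ /= -scalemxAl mxE. Qed.

Lemma dotvDl u v w : dotv (u + v) w = dotv u w + dotv v w.
Proof. by rewrite /dotv linearD /= mulmxDl mxE. Qed.

Lemma dotvBl u v w : dotv (u - v) w = dotv u w - dotv v w.
Proof. by rewrite /dotv linearB /= mulmxBl !mxE. Qed.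

Lemma dotvC u v : dotv u v = dotv v u.
Proof. by rewrite /dotv -[u^T *m v]trmxK trmx_mul trmxK mxE. Qed.

Lemma dotvDr u v w : dotv u (v + w) = dotv u v + dotv u w.
Proof. by rewrite !(dotvC u) dotvDl. Qed.

Lemma dotvZr (c : R) u v : dotv u (c *: v) = c * dotv u v.
Proof. by rewrite dotvC dotvZl dotvC. Qed.

Lemma quadZ (A : 'M[R]_d) (c : R) u : quad A (c *: u) = c ^+ 2 * quad A u.
Proof. by rewrite /quad -scalemxAr dotvZl dotvZr mulrA. Qed.

Lemma dot0v u : dotv 0 u = 0.
Proof. by rewrite -(scale0r u) dotvZl mul0r. Qed.

Lemma quad0 (A : 'M[R]_d) : quad A 0 = 0.
Proof. exact: dot0v. Qed.

Lemma quad_parallelogram (A : 'M[R]_d) u v :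
  quad A (u + v) + quad A (u - v) = 2 * quad A u + 2 * quad A v.
Proof.
rewrite -(scaleN1r v) /quad !mulmxDr -!scalemxAr !dotvDl !dotvDr !dotvZl !dotvZr.
ring.
Qed.

End DotProduct.

(** * Khintchine's inequality *)

Section SignAverage.
Context {R : realType}.

(** The expectation of [F] at [u] plus a Rademacher combination of the entries of [l]. The base
    point [u] is kept free for induction on [l]. *)
Fixpoint sign_avg {V : zmodType} (F : V -> R) (l : seq V) (u : V) : R :=
  if l is b :: l' then (sign_avg F l' (u + b) + sign_avg F l' (u - b)) / 2
  else F u.

Lemma le_sign_avg (V : zmodType) (F G : V -> R) (l : seq V) (u : V) :
  (forall w, F w <= G w) -> sign_avg F l u <= sign_avg G l u.
Proof.
move=> FG; elim: l u => [|b l IH] u //=.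
by rewrite ler_pM2r ?invr_gt0 ?ltr0n // lerD.
Qed.

Lemma sign_avg_lin (V : zmodType) (c1 c2 : R) (F G : V -> R) l u :
  sign_avg (fun w => c1 * F w + c2 * G w) l u =
  c1 * sign_avg F l u + c2 * sign_avg G l u.
Proof. by elim: l u => [|b l IH] u //=; rewrite !IH; ring. Qed.

Lemma sign_avg_cst (V : zmodType) (c : R) (l : seq V) u :
  sign_avg (fun=> c) l u = c.
Proof. by elim: l u => [|b l IH] u //=; rewrite !IH; field. Qed.

Lemma sign_avg_sum (V : zmodType) (I : finType) (F : I -> V -> R) l u :
  sign_avg (fun w => \sum_i F i w) l u = \sum_i sign_avg (F i) l u.
Proof.
elim: l u => [|b l IH] u //=.
by rewrite !IH -big_split /= big_distrl.
Qed.

Lemma sign_avg_comp (V W : zmodType) (f : V -> W) (F : W -> R) l u :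
    {morph f : x y / x + y} -> {morph f : x y / x - y} ->
  sign_avg (F \o f) l u = sign_avg F (map f l) (f u).
Proof. by move=> fD fB; elim: l u => [|b l IH] u //=; rewrite !IH fD fB. Qed.

Lemma sign_avg_sqr (l : seq R) (u : R) :
  sign_avg (fun x => x ^+ 2) l u = u ^+ 2 + \sum_(b <- l) b ^+ 2.
Proof.
elim: l u => [|b l IH] u /=; first by rewrite big_nil addr0.
by rewrite !IH big_cons; field.
Qed.

(** By induction: averaging the bound at [u + b] and [u - b] leaves a slack of exactly
    [2 * b ^+ 4]. *)
Lemma sign_avg_pow4 (l : seq R) (u : R) :
  sign_avg (fun x => x ^+ 4) l u <=
  u ^+ 4 + 6 * u ^+ 2 * (\sum_(b <- l) b ^+ 2) +
  3 * (\sum_(b <- l) b ^+ 2) ^+ 2.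
Proof.
elim: l u => [|b l IH] u /=; first by rewrite big_nil; lra.
rewrite big_cons; move: (IH (u + b)) (IH (u - b)).
move: (\sum_(j <- l) j ^+ 2) => S H1 H2.
have b4 : 0 <= b ^+ 4 by rewrite exprn_even_ge0.
suff -> : u ^+ 4 + 6 * u ^+ 2 * (b ^+ 2 + S) + 3 * (b ^+ 2 + S) ^+ 2 =
  (((u + b) ^+ 4 + 6 * (u + b) ^+ 2 * S + 3 * S ^+ 2) +
   ((u - b) ^+ 4 + 6 * (u - b) ^+ 2 * S + 3 * S ^+ 2)) / 2 + 2 * b ^+ 4 by lra.
by field.
Qed.

Lemma sign_avg_quad d (A : 'M[R]_d) (l : seq 'cV[R]_d) (u : 'cV[R]_d) :
  sign_avg (quad A) l u = quad A u + \sum_(b <- l) quad A b.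
Proof.
elim: l u => [|b l IH] u /=; first by rewrite big_nil addr0.
rewrite !IH big_cons addrACA quad_parallelogram.
by field.
Qed.

Lemma khintchine (l : seq R) :
  Num.sqrt (\sum_(b <- l) b ^+ 2) <= 2 * sign_avg (fun x => `|x|) l 0.
Proof.
set S := \sum_(b <- l) _.
have S0 : 0 <= S by apply: sumr_ge0 => b _; exact: sqr_ge0.
have [S_eq0|Spos] := eqVneq S 0.
  rewrite S_eq0 sqrtr0 mulr_ge0 //.
  rewrite -[leLHS](sign_avg_cst _ 0 l 0); exact: le_sign_avg.
set q := Num.sqrt S.
have q0 : 0 < q by rewrite sqrtr_gt0 lt_neqAle eq_sym Spos.
have qS : q ^+ 2 = S by rewrite sqr_sqrtr.
(* The tangent quartic [t >= (3 t^2 - t^4) / 2] at [t = |x| / (2 q)]. *)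
have pointwise x : 3 / (4 * q) * x ^+ 2 + (- (8 * q ^+ 3)^-1 / 2) * x ^+ 4 <= `|x|.
  rewrite -[x ^+ 2]real_normK ?num_real //.
  rewrite (_ : x ^+ 4 = `|x| ^+ 4); last first.
    by rewrite (exprM x 2 2) -[x ^+ 2]real_normK ?num_real // -exprM.
  move: `|x| (normr_ge0 x) => y y0.
  pose t := y / (2 * q).
  have -> : y = 2 * q * t by rewrite /t; field; rewrite gt_eqF.
  have t0 : 0 <= t by rewrite divr_ge0 // mulr_ge0 // ltW.
  rewrite -subr_ge0.
  suff -> : 2 * q * t -
     (3 / (4 * q) * (2 * q * t) ^+ 2 + (- (8 * q ^+ 3)^-1 / 2) * (2 * q * t) ^+ 4)
     = q * t * (t - 1) ^+ 2 * (t + 2).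
    have t2 : 0 <= t + 2 by lra.
    apply: mulr_ge0 => //; apply: mulr_ge0; last exact: sqr_ge0.
    by apply: mulr_ge0 => //; exact: ltW.
  by field; rewrite gt_eqF.
have := le_sign_avg _ _ _ l 0 pointwise.
rewrite sign_avg_lin sign_avg_sqr -/S => H.
have := sign_avg_pow4 l 0; rewrite -/S => H4.
have H4' : sign_avg (fun x => x ^+ 4) l 0 <= 3 * q ^+ 4.
  by apply: le_trans H4 _; rewrite -qS; lra.
have k0 : 0 <= (8 * q ^+ 3)^-1 / 2.
  by rewrite divr_ge0 // invr_ge0 mulr_ge0 // exprn_ge0 // ltW.
have H5 := ler_wpM2l k0 H4'.
have e1 : (8 * q ^+ 3)^-1 / 2 * (3 * q ^+ 4) = 3 / 16 * q.
  by field; rewrite gt_eqF.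
have e2 : 3 / (4 * q) * (0 ^+ 2 + S) = 3 / 4 * q.
  by rewrite -qS; field; rewrite gt_eqF.
(* The average of [|x|] is at least [3/4 * q - 3/16 * q = 9/16 * q], which exceeds [q / 2]. *)
rewrite e1 in H5; rewrite e2 in H; lra.
Qed.

End SignAverage.

(** * Selecting the perturbations *)

Section Selection.
Context {R : realType} {d n : nat}.
Variables (A : 'M[R]_d) (D : 'I_n -> 'cV[R]_d) (B : R).
Hypothesis quad_ge0 : forall u, 0 <= quad A u.
Hypothesis B_gt0 : 0 < B.
Hypothesis abs_le : forall u, \sum_i `|dotv u (D i)| <= B * Num.sqrt (quad A u).

(* [spread l i ^+ 2] is the quadratic form [\sum_(b <- l) b b^T] at [D i]. *)
Definition spread (l : seq 'cV[R]_d) (i : 'I_n) : R :=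
  Num.sqrt (\sum_(b <- l) dotv b (D i) ^+ 2).

(** Khintchine bounds each [spread l i] by twice the average of [|u . D i|] over random signed sums
    [u] of [l]. After [abs_le], the bound [y <= (y ^+ 2 + 1) / 2] replaces the square root by
    [quad A u], whose average is exact. *)
Lemma sum_spread_le (l : seq 'cV[R]_d) :
  \sum_(b <- l) quad A b <= 1 -> \sum_i spread l i <= 2 * B.
Proof.
move=> l1.
apply: (@le_trans _ _ (2 * sign_avg (fun u => \sum_i `|dotv u (D i)|) l 0)).
  rewrite sign_avg_sum mulr_sumr; apply: ler_sum => i _.
  have := @khintchine R (map (fun u => dotv u (D i)) l); rewrite big_map.
  rewrite -{2}(dot0v (D i)) -(sign_avg_comp _ _ (fun u => dotv u (D i))) //.
  - by move=> u v; exact: dotvDl.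
  - by move=> u v; exact: dotvBl.
rewrite ler_pM2l //.
apply: (@le_trans _ _ (sign_avg (fun u => B / 2 * quad A u + B / 2 * 1) l 0)).
  apply: le_sign_avg => u; apply: le_trans (abs_le u) _.
  rewrite -{2}[quad A u]sqr_sqrtr //; move: (Num.sqrt _) => y.
  rewrite -mulrDr -mulrA ler_pM2l //.
  by have := sqr_ge0 (y - 1); rewrite sqrrB1; lra.
rewrite sign_avg_lin sign_avg_quad sign_avg_cst.
rewrite quad0 add0r mulr1.
have : B / 2 * \sum_(b <- l) quad A b <= B / 2 * 1.
  by rewrite ler_pM2l // divr_gt0.
lra.
Qed.

Lemma dotv_le (u : 'cV[R]_d) i : `|dotv u (D i)| <= B * Num.sqrt (quad A u).
Proof.
apply: le_trans (abs_le u); rewrite (bigD1 i) //= lerDl.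
by apply: sumr_ge0.
Qed.

(* Rank-one perturbation of a near-maximiser [l] of [\sum_i spread l i]:
   concavity in [\sum_(b <- l) b b^T] bounds the directional derivative. *)
Lemma sum_sqr_small_spread (tau : R) : 0 < tau ->
  exists G : {set 'I_n}, #|~: G|%:R * tau <= 2 * B /\
    forall u, \sum_(i in G) dotv u (D i) ^+ 2 <= 9 * tau * B * quad A u.
Proof.
move=> tau0.
pose feas := [set l : seq 'cV[R]_d | \sum_(b <- l) quad A b <= 1].
pose E := [set \sum_i spread l i | l in feas].
have hE : has_sup E.
  split; last by exists (2 * B) => _ [l ll <-]; exact: sum_spread_le.
  by exists (\sum_i spread [::] i), [::]; rewrite //= /feas /= big_nil.
(* [r] is the weight of the added vector. Since [r * B <= tau], adding it raises a spread by at most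
   [tau]. The optimality gap [r ^+ 2 * B] below has the same order as the gain, so [r] cancels at
   the end. *)
pose r := Num.min (1 / 2) (tau / B).
have r0 : 0 < r by rewrite lt_min !divr_gt0.
have r2 : r <= 1 / 2 by rewrite ge_min lexx.
have rB : r * B <= tau by rewrite -ler_pdivlMr // ge_min lexx orbT.
have eta0 : 0 < r ^+ 2 * B by rewrite mulr_gt0 // exprn_gt0.
have [_ [l lf <-] lopt] := sup_adherent eta0 hE.
have lB := sum_spread_le l lf.
have s0 k i : 0 <= spread k i by exact: sqrtr_ge0.
pose G := [set i | spread l i <= tau]%SET.
exists G; split.
  apply: le_trans lB.
  apply: (@le_trans _ _ (\sum_(i in ~: G) spread l i)).
    rewrite -sumr_const mulr_suml.
    apply: ler_sum => i; rewrite !inE mul1r -ltNge; exact: ltW.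
  by rewrite [leRHS](bigID (mem (~: G))) /= lerDl sumr_ge0.
have unit_case v : quad A v = 1 ->
    \sum_(i in G) dotv v (D i) ^+ 2 <= 9 * tau * B.
  move=> v1.
  (* Shrinking [l] by [c] makes room for [r *: v]: the new family [l'] stays feasible because
     [r ^+ 2 + c ^+ 2 = 1]. *)
  pose c := Num.sqrt (1 - r ^+ 2).
  have r21 : r ^+ 2 <= 1 / 2 by nra.
  have c2 : c ^+ 2 = 1 - r ^+ 2 by rewrite sqr_sqrtr //; lra.
  have c0 : 0 <= c by exact: sqrtr_ge0.
  have c1 : c <= 1 by nra.
  have cr : 1 - r ^+ 2 <= c by nra.
  pose l' := r *: v :: map (fun b => c *: b) l.
  have l'f : feas l'.
    rewrite /feas /= big_cons big_map quadZ v1.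
    under eq_bigr do rewrite quadZ.
    rewrite -mulr_sumr c2.
    move: lf; rewrite /feas /=; move: (\sum_(b <- l) _) => q q1; nra.
  have s'E i : spread l' i ^+ 2 =
      r ^+ 2 * dotv v (D i) ^+ 2 + c ^+ 2 * spread l i ^+ 2.
    have nn (k : seq 'cV[R]_d) : 0 <= \sum_(e <- k) dotv e (D i) ^+ 2.
      by apply: sumr_ge0 => e _; exact: sqr_ge0.
    rewrite /spread !(sqr_sqrtr (nn _)).
    rewrite big_cons big_map dotvZl exprMn mulr_sumr; congr (_ + _).
    by apply: eq_bigr => b _; rewrite dotvZl exprMn.
  have s'ge i : c * spread l i <= spread l' i.
    rewrite -ler_sqr ?nnegrE ?mulr_ge0 //.
    by rewrite s'E exprMn lerDr; apply: mulr_ge0; exact: sqr_ge0.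
  (* A difference of squares whose sum factor is at most [tau + 2 * tau] on [G]. *)
  have gain i : i \in G ->
      r ^+ 2 * dotv v (D i) ^+ 2 <= 3 * tau * (spread l' i - c * spread l i).
    rewrite inE => iG.
    have bB := dotv_le v i; rewrite v1 sqrtr1 mulr1 in bB.
    have s'le : spread l' i <= r * `|dotv v (D i)| + c * spread l i.
      rewrite -ler_sqr ?nnegrE ?addr_ge0 ?mulr_ge0 // ?(ltW r0) //.
      rewrite s'E -[dotv v (D i) ^+ 2]real_normK ?num_real //.
      rewrite sqrrD !exprMn.
      rewrite -addrA lerD2l lerDr mulrn_wge0 //.
      by rewrite !mulr_ge0 // ltW.
    have -> : r ^+ 2 * dotv v (D i) ^+ 2 =
      (spread l' i + c * spread l i) * (spread l' i - c * spread l i).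
      by rewrite -[LHS](addrK (c ^+ 2 * spread l i ^+ 2)) -s'E; ring.
    apply: ler_wpM2r; first by rewrite subr_ge0.
    have : r * `|dotv v (D i)| <= r * B by rewrite ler_pM2l.
    have : c * spread l i <= 1 * spread l i by apply: ler_wpM2r.
    lra.
  have sup' : \sum_i spread l' i <= sup E.
    by apply: sup_upper_bound => //; exists l'.
  have total : r ^+ 2 * \sum_(i in G) dotv v (D i) ^+ 2 <=
      3 * tau * (\sum_i spread l' i - c * \sum_i spread l i).
    rewrite mulr_sumr mulr_sumr -sumrB mulr_sumr.
    apply: le_trans (ler_sum _ gain) _.
    rewrite [leRHS](bigID (mem G)) /= lerDl sumr_ge0 // => i _.
    by rewrite mulr_ge0 ?subr_ge0 // mulr_ge0 // ltW.
  have F0 : 0 <= \sum_i spread l i by apply: sumr_ge0.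
  (* Near-optimality contributes [r ^+ 2 * B]; the shrinking contributes
     [(1 - c) * F <= r ^+ 2 * (2 * B)]. *)
  have diff : \sum_i spread l' i - c * \sum_i spread l i <= 3 * r ^+ 2 * B.
    move: F0 lB lopt sup'; move: (\sum_i spread l i) (\sum_i spread l' i) => F F'.
    move=> F0 lB lopt sup'.
    have : (1 - c) * F <= r ^+ 2 * (2 * B) by apply: ler_pM => //; lra.
    lra.
  rewrite -(@ler_pM2l _ (r ^+ 2)) ?exprn_gt0 //.
  apply: le_trans total _.
  have -> : r ^+ 2 * (9 * tau * B) = 3 * tau * (3 * r ^+ 2 * B) by ring.
  by rewrite ler_pM2l // mulr_gt0.
move=> u; have [u0|un0] := eqVneq (quad A u) 0.
  rewrite u0 mulr0 big1 // => i _.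
  have := dotv_le u i; rewrite u0 sqrtr0 mulr0 normr_le0 => /eqP ->.
  by rewrite expr0n.
have q0 : 0 < quad A u by rewrite lt_neqAle eq_sym un0 quad_ge0.
pose k := (Num.sqrt (quad A u))^-1.
have k2 : k ^+ 2 * quad A u = 1 by rewrite exprVn sqr_sqrtr // mulVf.
have := unit_case (k *: u); rewrite quadZ => /(_ k2).
under eq_bigr do rewrite dotvZl exprMn.
rewrite -mulr_sumr => H.
have := ler_wpM2r (quad_ge0 u) H.
by rewrite mulrAC k2 mul1r.
Qed.

End Selection.

(** * Stability of perturbed scalar samples *)

Section ScalarStability.
Context {R : realType} {n : nat}.
Variables (a b : 'I_n -> R) (eps gamma r2 q : R).
Hypothesis eps_gt0 : 0 < eps.
Hypothesis eps_lt : eps < 1 / 4.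
Hypothesis eps_le_gamma : eps <= gamma.
Hypothesis eps_n : 1 <= eps * n%:R.
Hypothesis q_ge0 : 0 <= q.
Hypothesis r2_ge0 : 0 <= r2.
Hypothesis stable : forall J : {set 'I_n}, (1 - eps) * n%:R <= #|J|%:R ->
  (1 - gamma) * q * #|J|%:R <= \sum_(i in J) a i ^+ 2 <= (1 + gamma) * q * #|J|%:R.

Let gamma_gt0 : 0 < gamma. Proof. exact: lt_le_trans eps_le_gamma. Qed.
Let n_ge0 : 0 <= n%:R :> R. Proof. by []. Qed.

Let sum_setC (f : 'I_n -> R) (J : {set 'I_n}) :
  \sum_i f i = \sum_(i in J) f i + \sum_(i in ~: J) f i.
Proof.
rewrite (bigID (mem J)) /=; congr (_ + _).
by apply: eq_bigl => i; rewrite inE.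
Qed.

Let card_setC (J : {set 'I_n}) : n%:R = #|J|%:R + #|~: J|%:R :> R.
Proof. by rewrite -natrD cardsC card_ord. Qed.

Lemma total_bounds :
  (1 - gamma) * q * n%:R <= \sum_i a i ^+ 2 <= (1 + gamma) * q * n%:R.
Proof.
have := stable [set: 'I_n]%SET; rewrite cardsT card_ord.
rewrite (eq_bigl predT) => [|i]; last by rewrite inE.
by apply; rewrite mulrBl mul1r gerBl mulr_ge0 // ltW.
Qed.

(** Stability bounds the total from above and the sum over the complement from below; subtract. *)
Lemma small_set_sum (J : {set 'I_n}) : #|J|%:R <= eps * n%:R ->
  \sum_(i in J) a i ^+ 2 <= 3 * gamma * q * n%:R.
Proof.
move=> Jle; have nE := card_setC J.
have /andP[lo _] : (1 - gamma) * q * #|~: J|%:R <= \sum_(i in ~: J) a i ^+ 2 <=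
    (1 + gamma) * q * #|~: J|%:R by apply: stable; lra.
have /andP[_ up] := total_bounds.
move: up; rewrite (sum_setC _ J) => up.
have k0 : 0 <= #|J|%:R :> R by [].
have k1 : 0 <= #|~: J|%:R :> R by [].
have kn : #|J|%:R * q <= gamma * n%:R * q.
  apply: ler_wpM2r => //; apply: le_trans Jle _.
  exact: ler_wpM2r.
have kg : 0 <= gamma * q * #|J|%:R by rewrite !mulr_ge0 // ltW.
rewrite {1}nE in up; rewrite nE in kn *; lra.
Qed.

(** The largest cardinality allowed in [small_set_sum]. By [eps_n] it is at least 1, so
    [eps * n < m + 1 <= 2 * m]. *)
Let m := Num.trunc (eps * n%:R).

Let m_le : m%:R <= eps * n%:R.
Proof. by case/andP: (trunc_itv (le_trans ler01 eps_n)). Qed.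

Let lt_m : eps * n%:R < m%:R + 1.
Proof. by case/andP: (trunc_itv (le_trans ler01 eps_n)) => _; rewrite -natr1. Qed.

Let m_gt0 : (0 < m)%N.
Proof. by rewrite lt0n; apply: contraTneq lt_m => ->; rewrite add0r -leNgt. Qed.

Let m_ge1 : 1 <= m%:R :> R. Proof. by rewrite ler1n. Qed.

Let subset_of_card (J : {set 'I_n}) k : (k <= #|J|)%N ->
  exists2 L : {set 'I_n}, L \subset J & #|L| = k.
Proof.
case/card_geqP => s [us ss sJ]; exists [set i in s]%SET.
  by apply/fintype.subsetP => i; rewrite inE => /sJ.
by rewrite cardsE -ss; apply/card_uniqP.
Qed.

(** Peel off blocks of [m] indices, each covered by [small_set_sum]. *)
Lemma medium_set_sum k (J : {set 'I_n}) : (#|J| <= k * m)%N ->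
  \sum_(i in J) a i ^+ 2 <= k%:R * (3 * gamma * q * n%:R).
Proof.
have c0 : 0 <= 3 * gamma * q * n%:R by rewrite !mulr_ge0 // ltW.
elim: k J => [|k IH] J.
  rewrite mul0n leqn0 cards_eq0 => /eqP ->.
  by rewrite big_set0 mul0r.
move=> Jle; have [Jm|mJ] := leqP #|J| m.
  apply: le_trans (small_set_sum J _) _.
    by apply: le_trans m_le; rewrite ler_nat.
  by rewrite -[k.+1%:R]natr1 (mulrDl k%:R) mul1r lerDr mulr_ge0.
have [L LJ Lm] := subset_of_card J m (ltnW mJ).
rewrite (big_setID L) /= (finset.setIidPr LJ) -[k.+1%:R]natr1 (mulrDl k%:R) mul1r addrC.
apply: lerD; last by apply: small_set_sum; rewrite Lm.
apply: IH; rewrite cardsD (finset.setIidPr LJ) Lm leq_subLR.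
by rewrite -mulSn.
Qed.

(* Points with [a i ^+ 2] above the [eps]-quantile level [6 gamma q / eps] carry
   little mass; on the others [a i] is bounded, and the [l1] bound on [b] wins. *)
Lemma cross_sum (rho : R) : 0 < rho -> r2 = rho ^+ 2 / eps ->
  \sum_i `|b i| <= n%:R * rho * Num.sqrt q ->
  \sum_i b i ^+ 2 <= 18 * r2 * q * n%:R ->
  \sum_i `|a i * b i| <= (9 / 2 * gamma + 19 / 2 * r2) * q * n%:R.
Proof.
move=> rho0 r2E b1 b2.
pose th := 6 * gamma * q / eps.
have th0 : 0 <= th by rewrite divr_ge0 ?mulr_ge0 // ltW.
pose h := Num.sqrt th.
have h0 : 0 <= h by exact: sqrtr_ge0.
have h2 : h ^+ 2 = th by rewrite sqr_sqrtr.
pose L := [set i | th < a i ^+ 2]%SET.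
(* Otherwise [m] of these points carry more than [m * th >= eps * n / 2 * th = 3 * gamma * q * n],
   against [small_set_sum]. *)
have Lm : (#|L| <= m)%N.
  rewrite leqNgt; apply/negP => mL.
  have [L' L'L L'm] := subset_of_card L m (ltnW mL).
  have up := small_set_sum L'; rewrite L'm in up; have {}up := up m_le.
  have lo : m%:R * th < \sum_(i in L') a i ^+ 2.
    rewrite -L'm -sumr_const mulr_suml.
    have /card_gt0P[j jL'] : (0 < #|L'|)%N by rewrite L'm.
    apply: ltr_sum; last first.
      by move=> i /(fintype.subsetP L'L); rewrite inE mul1r.
    by apply/hasP; exists j => //; rewrite mem_index_enum.
  have : eps * n%:R / 2 * th <= m%:R * th.
    apply: ler_wpM2r => //; move: lt_m m_ge1.
    by move: (m%:R : R) (eps * n%:R) => x y; lra.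
  have -> : eps * n%:R / 2 * th = 3 * gamma * q * n%:R.
    by rewrite /th; field; rewrite gt_eqF.
  lra.
have La : \sum_(i in L) a i ^+ 2 <= 3 * gamma * q * n%:R.
  by apply: small_set_sum; apply: le_trans m_le; rewrite ler_nat.
have Lb : \sum_(i in L) b i ^+ 2 <= 18 * r2 * q * n%:R.
  apply: le_trans b2; rewrite (sum_setC _ L) lerDl.
  by apply: sumr_ge0 => i _; exact: sqr_ge0.
have Lab : \sum_(i in L) `|a i * b i| <=
    (\sum_(i in L) a i ^+ 2 + \sum_(i in L) b i ^+ 2) / 2.
  rewrite -big_split /= mulr_suml; apply: ler_sum => i _.
  rewrite normrM -[a i ^+ 2]real_normK ?num_real // -[b i ^+ 2]real_normK ?num_real //.
  by have := sqr_ge0 (`|a i| - `|b i|); rewrite sqrrB; lra.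
have LCab : \sum_(i in ~: L) `|a i * b i| <= h * (n%:R * rho * Num.sqrt q).
  apply: le_trans (_ : h * \sum_(i in ~: L) `|b i| <= _).
    rewrite mulr_sumr; apply: ler_sum => i; rewrite !inE -leNgt => ai.
    rewrite normrM; apply: ler_wpM2r => //.
    by rewrite -ler_sqr ?nnegrE // h2 real_normK ?num_real.
  apply: ler_wpM2l => //; apply: le_trans b1.
  by rewrite (sum_setC _ L) lerDr; apply: sumr_ge0.
(* AM-GM with weight [eps]: [h * y <= (eps * h ^+ 2 + y ^+ 2 / eps) / 2]. *)
have amgm : h * (rho * Num.sqrt q) <= (6 * gamma + r2) / 2 * q.
  have sq2 : Num.sqrt q ^+ 2 = q by rewrite sqr_sqrtr.
  have -> : (6 * gamma + r2) / 2 * q = (eps * h ^+ 2 + (rho * Num.sqrt q) ^+ 2 / eps) / 2.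
    by rewrite h2 exprMn sq2 r2E /th; field; rewrite gt_eqF.
  move: (rho * Num.sqrt q) => y.
  have := mulr_ge0 (ltW eps_gt0) (sqr_ge0 (h - y / eps)).
  have -> : eps * (h - y / eps) ^+ 2 = eps * h ^+ 2 + y ^+ 2 / eps - 2 * (h * y).
    by field; rewrite gt_eqF.
  lra.
have := ler_wpM2r n_ge0 amgm.
rewrite (sum_setC _ L) => H.
have -> : (9 / 2 * gamma + 19 / 2 * r2) * q * n%:R =
  (3 * gamma * q * n%:R + 18 * r2 * q * n%:R) / 2 + (6 * gamma + r2) / 2 * q * n%:R.
  by field.
apply: lerD; first lra.
apply: le_trans LCab _; apply: le_trans _ H.
by rewrite le_eqVlt; apply/orP; left; apply/eqP; ring.
Qed.

(** [J] may miss [2 * eps * n] indices, too many for [stable], so the sum of [a i ^+ 2] over [J] is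
    obtained from the total by removing the complement. The square is then expanded. *)
Lemma perturbed_stable (rho : R) (J : {set 'I_n}) :
  0 < rho -> r2 = rho ^+ 2 / eps ->
  \sum_i `|b i| <= n%:R * rho * Num.sqrt q ->
  \sum_i b i ^+ 2 <= 18 * r2 * q * n%:R ->
  (1 - 2 * eps) * n%:R <= #|J|%:R ->
  (1 - 100 * (gamma + r2)) * q * #|J|%:R <= \sum_(i in J) (a i + b i) ^+ 2
    <= (1 + 100 * (gamma + r2)) * q * #|J|%:R.
Proof.
move=> rho0 r2E b1 b2 Jge.
have cross := cross_sum rho rho0 r2E b1 b2.
have nE := card_setC J.
have k0 : 0 <= #|J|%:R :> R by [].
have k1 : 0 <= #|~: J|%:R :> R by [].
have n2J : n%:R <= 2 * #|J|%:R :> R.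
  have : eps * n%:R <= 1 / 4 * n%:R by apply: ler_wpM2r => //; exact: ltW.
  lra.
have JCle : #|~: J|%:R <= 2 * (eps * n%:R) by lra.
(* Four blocks suffice: [2 * eps * n < 2 * (m + 1) <= 4 * m]. *)
have JC : \sum_(i in ~: J) a i ^+ 2 <= 4%:R * (3 * gamma * q * n%:R).
  apply: medium_set_sum; rewrite -(ler_nat R) natrM.
  move: lt_m m_ge1 JCle; move: (m%:R : R) (eps * n%:R) => x y; lra.
have /andP[lo up] := total_bounds.
rewrite !(sum_setC (fun i => a i ^+ 2) J) in lo up.
have JCq : #|~: J|%:R * q <= 2 * (gamma * n%:R * q).
  rewrite mulrA; apply: ler_wpM2r => //; apply: le_trans JCle _.
  by rewrite ler_pM2l //; apply: ler_wpM2r.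
have JC0 : 0 <= \sum_(i in ~: J) a i ^+ 2.
  by apply: sumr_ge0 => i _; exact: sqr_ge0.
have crossJ : `|\sum_(i in J) a i * b i| <= (9 / 2 * gamma + 19 / 2 * r2) * q * n%:R.
  apply: le_trans (ler_norm_sum _ _ _) _; apply: le_trans cross.
  by rewrite (sum_setC _ J) lerDl; apply: sumr_ge0.
move: crossJ; rewrite ler_norml => /andP[cl cu].
have bJ : \sum_(i in J) b i ^+ 2 <= 18 * r2 * q * n%:R.
  apply: le_trans b2; rewrite (sum_setC _ J) lerDl.
  by apply: sumr_ge0 => i _; exact: sqr_ge0.
have bJ0 : 0 <= \sum_(i in J) b i ^+ 2.
  by apply: sumr_ge0 => i _; exact: sqr_ge0.
have -> : \sum_(i in J) (a i + b i) ^+ 2 = \sum_(i in J) a i ^+ 2 +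
    2 * (\sum_(i in J) a i * b i) + \sum_(i in J) b i ^+ 2.
  rewrite mulr_sumr -!big_split /=; apply: eq_bigr => i _; ring.
have qn : q * n%:R = q * #|J|%:R + q * #|~: J|%:R by rewrite nE mulrDr.
have eqn : (gamma + r2) * q * n%:R <= 2 * ((gamma + r2) * q * #|J|%:R).
  have : (gamma + r2) * q * n%:R <= (gamma + r2) * q * (2 * #|J|%:R).
    by apply: ler_wpM2l => //; rewrite mulr_ge0 // addr_ge0 // ltW.
  lra.
have g0 : 0 <= gamma * q * n%:R by rewrite !mulr_ge0 // ltW.
have r0 : 0 <= r2 * q * n%:R by rewrite !mulr_ge0.
have qJC : 0 <= q * #|~: J|%:R by rewrite mulr_ge0.
(* The errors total at most [(22 * gamma + 37 * r2) * q * n]; passing from [n] to [2 * #|J|] doubles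
   this, still below 100. *)
apply/andP; split; lra.
Qed.

End ScalarStability.

(** * Stability of indexed samples *)

Section Multisets.
Context {K : choiceType}.
Implicit Types S T : {mset K}.

Lemma size_seq_mset (s : seq K) : size (seq_mset s) = size s.
Proof. exact/perm_size/perm_eq_seq_mset. Qed.

Lemma size_msetD S T : size (S `+` T)%mset = (size S + size T)%N.
Proof.
have -> : (S `+` T)%mset = seq_mset ((S : seq K) ++ T).
  by apply/msetP => y; rewrite msetE2 mset_seqE count_cat !count_mem_mset.
by rewrite size_seq_mset size_cat.
Qed.

Lemma msubset_size S T : msubset S T -> (size S <= size T)%N.
Proof.
move=> /msubsetP ST.
have [s sT /perm_size ->] : exists2 s, subseq s T & perm_eq S s.
  by apply/count_subseqP => y; rewrite !count_mem_mset.
exact: size_subseq.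
Qed.

Context {n : nat}.
Implicit Types (f g : 'I_n -> K) (J : {set 'I_n}).

Definition mset_img f J : {mset K} := seq_mset [seq f i | i <- enum J].

Lemma size_mset_img f J : size (mset_img f J) = #|J|.
Proof. by rewrite size_seq_mset size_map cardE. Qed.

Lemma big_mset_img (V : nmodType) (F : K -> V) f J :
  \sum_(y <- mset_img f J) F y = \sum_(i in J) F (f i).
Proof.
by rewrite (perm_big _ (perm_eq_seq_mset _)) big_map big_enum.
Qed.

Lemma mset_img_sub f J : msubset (mset_img f J) (seq_mset (codom f)).
Proof.
apply/msubsetP; rewrite /codom /image_mem => y; rewrite !mset_seqE.
apply: leq_count_subseq; apply: map_subseq.
by rewrite {1}/enum_mem [enum 'I_n]enumT filter_subseq.
Qed.

(** Up to permutation [S] is a subsequence of [codom f]; the mask selecting it gives [J], even when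
    [f] repeats values. *)
Lemma msubset_codomP f S : msubset S (seq_mset (codom f)) ->
  exists J, S = mset_img f J.
Proof.
move=> /msubsetP Sf.
have [s sf pS] : exists2 s, subseq s (codom f) & perm_eq S s.
  by apply/count_subseqP => y; rewrite count_mem_mset; have := Sf y; rewrite mset_seqE.
have [msk _ sE] := subseqP sf.
have {}sE : s = map f (mask msk (enum 'I_n)) by rewrite sE map_mask.
exists [set i in mask msk (enum 'I_n)]%SET.
rewrite -[LHS]seq_mset_id; apply/eq_seq_msetP; apply: (perm_trans pS).
rewrite sE; apply: perm_map; apply: uniq_perm => [||i].
- exact/mask_uniq/enum_uniq.
- exact: enum_uniq.
- by rewrite mem_enum inE.
Qed.

Lemma codom_setC f J :
  seq_mset (codom f) = (mset_img f J `+` mset_img f (~: J))%mset.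
Proof.
apply/msetP => y; rewrite msetE2 !mset_seqE -count_cat -map_cat.
apply/permP/perm_map/uniq_perm => [||i].
- exact: enum_uniq.
- rewrite cat_uniq !enum_uniq /= andbT; apply/hasPn => i.
  by rewrite !mem_enum inE.
- by rewrite mem_cat !mem_enum !inE orbN.
Qed.

(** Both families share the part over [J]; the rest of [f] adds at most its own size to the
    intersection. *)
Lemma size_msetI_agree f g J T : {in J, f =1 g} ->
  (size (T `&` seq_mset (codom f))%mset <=
    size (T `&` seq_mset (codom g))%mset + #|~: J|)%N.
Proof.
move=> fg; rewrite -(size_mset_img f) -size_msetD; apply: msubset_size.
apply/msubsetP => y; rewrite !(codom_setC _ J).
have -> : mset_img f J = mset_img g J.
  by rewrite /mset_img; congr seq_mset; apply/eq_in_map => i; rewrite mem_enum => /fg.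
rewrite !msetE2; lia.
Qed.

End Multisets.

(** * Stability direction by direction, and whitening *)

Section Stability.
Context {R : realType} {d n : nat}.
Implicit Types (A M Sigma : 'M[R]_d) (u v x : 'cV[R]_d).

Lemma quadDl A M u : quad (A + M) u = quad A u + quad M u.
Proof. by rewrite /quad mulmxDl dotvDr. Qed.

Lemma quadZl (c : R) A u : quad (c *: A) u = c * quad A u.
Proof. by rewrite /quad -scalemxAl dotvZr. Qed.

Lemma quadBl A M u : quad (A - M) u = quad A u - quad M u.
Proof. by rewrite -scaleN1r quadDl quadZl mulN1r. Qed.

Lemma quad_outer x u : quad (x *m x^T) u = dotv u x ^+ 2.
Proof.
rewrite /quad {1}/dotv !mulmxA -mulmxA mxE big_ord1 expr2; congr (_ * _).
exact: dotvC.
Qed.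

Lemma quad_second_moment (S : {mset 'cV[R]_d}) u :
  quad (second_moment S) u = (size S)%:R^-1 * \sum_(x <- S) dotv u x ^+ 2.
Proof.
rewrite quadZl; congr (_ * _).
rewrite (big_morph (fun A => quad A u) (fun A M => quadDl A M u) (id1 := 0)).
  by apply: eq_bigr => x _; rewrite quad_outer.
by rewrite -(scale0r 0) quadZl mul0r.
Qed.

Lemma second_moment_sym (S : {mset 'cV[R]_d}) :
  (second_moment S)^T = second_moment S.
Proof.
rewrite linearZ linear_sum /=; congr (_ *: _).
by apply: eq_bigr => x _; rewrite trmx_mul trmxK.
Qed.

Lemma loewner_leP A M : A^T = A -> M^T = M ->
  loewner_le A M <-> forall u, quad A u <= quad M u.
Proof.
move=> As Ms; split=> [[_ AM] u|AM].
  by rewrite -subr_ge0 -quadBl.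
by split=> [|u]; rewrite ?linearB /= ?As ?Ms // quadBl subr_ge0.
Qed.

Lemma pca_stable_sum (f : 'I_n -> 'cV[R]_d) (eps gamma : R) Sigma :
  pca_stable (seq_mset (codom f)) eps gamma Sigma ->
  forall (J : {set 'I_n}) u, (1 - eps) * n%:R <= #|J|%:R ->
    (1 - gamma) * quad Sigma u * #|J|%:R <= \sum_(i in J) dotv u (f i) ^+ 2
      <= (1 + gamma) * quad Sigma u * #|J|%:R.
Proof.
case=> _ [Ss _] st J u Jn.
have [J0|Jn0] := eqVneq #|J| 0%N.
  move/eqP: (J0); rewrite cards_eq0 => /eqP JE.
  by rewrite J0 !mulr0 JE big_set0 lexx.
have Jpos : 0 < #|J|%:R :> R by rewrite ltr0n lt0n.
have [|lo up] := st (mset_img f J) (mset_img_sub f J).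
  by rewrite size_seq_mset size_codom card_ord size_mset_img.
have sym c : (c *: Sigma)^T = c *: Sigma by rewrite linearZ /= Ss.
move/loewner_leP: lo => /(_ (sym _) (second_moment_sym _) u).
move/loewner_leP: up => /(_ (second_moment_sym _) (sym _) u).
rewrite quad_second_moment size_mset_img big_mset_img mulrC !quadZl.
by rewrite ler_pdivrMr // ler_pdivlMr // => -> ->.
Qed.

Lemma sum_pca_stable (f : 'I_n -> 'cV[R]_d) (eps gamma : R) Sigma :
  (0 < n)%N -> 0 < eps <= gamma -> eps < 1 -> psd Sigma ->
  (forall (J : {set 'I_n}) u, (1 - eps) * n%:R <= #|J|%:R ->
    (1 - gamma) * quad Sigma u * #|J|%:R <= \sum_(i in J) dotv u (f i) ^+ 2
      <= (1 + gamma) * quad Sigma u * #|J|%:R) ->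
  pca_stable (seq_mset (codom f)) eps gamma Sigma.
Proof.
move=> n0 eg e1 Sp st; split=> // _ /msubset_codomP[J ->].
rewrite size_seq_mset size_codom card_ord size_mset_img => Jn.
have Jpos : 0 < #|J|%:R :> R.
  by apply: lt_le_trans Jn; rewrite mulr_gt0 ?ltr0n ?subr_gt0.
have sym c : (c *: Sigma)^T = c *: Sigma by rewrite linearZ /= Sp.1.
have E u : quad (second_moment (mset_img f J)) u =
    (\sum_(i in J) dotv u (f i) ^+ 2) / #|J|%:R.
  by rewrite quad_second_moment size_mset_img big_mset_img mulrC.
split; (apply/loewner_leP; [by rewrite ?second_moment_sym|
  by rewrite ?second_moment_sym|move=> u; rewrite E quadZl]).
- by rewrite ler_pdivlMr //; case/andP: (st J u Jn).
- by rewrite ler_pdivrMr //; case/andP: (st J u Jn).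
Qed.

Lemma posdef_unitmx Sigma : posdef Sigma -> Sigma \in unitmx.
Proof.
case=> _ Sp; rewrite -row_free_unit -kermx_eq0; apply/rowV0P => v /sub_kermxP vS.
apply/eqP; apply/negPn/negP => v0.
have /Sp : v^T != 0 by rewrite trmx_eq0.
by rewrite /quad /dotv trmxK mulmxA vS mul0mx mxE ltxx.
Qed.

Lemma posdef_psd Sigma : posdef Sigma -> psd Sigma.
Proof.
case=> Ss Sp; split=> // v; have [->|/Sp/ltW//] := eqVneq v 0.
by rewrite quad0.
Qed.

(* Whitening: substitute [v = Sigma^(1/2) u / |Sigma^(1/2) u|], whose denominator
   is [sqrt (u^T Sigma u)]. *)
Lemma strong_sum_le Sigma M (D : 'I_n -> 'cV[R]_d) (rho : R) :
  (0 < n)%N -> 0 <= rho -> posdef Sigma -> is_invsqrt Sigma M ->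
  (ereal_sup [set (n%:R^-1 * \sum_(i < n) `|dotv v (M *m D i)|)%:E
             | v in unit_vec] <= rho%:E)%E ->
  forall u, \sum_i `|dotv u (D i)| <= n%:R * rho * Num.sqrt (quad Sigma u).
Proof.
move=> n0 rho0 Sp [[Ms _] MM] sup_le u.
have Su := posdef_unitmx _ Sp.
have Mu : M \in unitmx.
  by have := Su; rewrite -unitmx_inv -MM unitmx_mul andbb.
(* [invmx M] plays the part of [Sigma^(1/2)]. *)
have invM2 : invmx M *m invmx M = Sigma.
  rewrite -[RHS]mulmx1 -(mulmxV Mu) mulmxA -[Sigma *m M]mulmx1 -(mulmxV Mu).
  by rewrite (mulmxA _ M) -(mulmxA Sigma) MM mulmxV // mul1mx.
have [->|u0] := eqVneq u 0.
  rewrite big1 ?mulr_ge0 ?sqrtr_ge0 // => i _.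
  by rewrite dot0v normr0.
have q0 : 0 < quad Sigma u by apply: Sp.2.
set q := quad Sigma u in q0 *.
have s0 : 0 < Num.sqrt q by rewrite sqrtr_gt0.
pose w := invmx M *m u.
have wt : w^T = u^T *m invmx M by rewrite trmx_mul trmx_inv Ms.
have ww : dotv w w = q by rewrite /dotv wt -mulmxA /w (mulmxA (invmx M)) invM2.
pose v := (Num.sqrt q)^-1 *: w.
have v1 : unit_vec v.
  rewrite /unit_vec /= /norm2 dotvZl dotvZr ww mulrA -invfM -expr2 sqr_sqrtr ?ltW //.
  by rewrite mulVf ?sqrtr1 // gt_eqF.
have dv i : `|dotv v (M *m D i)| = (Num.sqrt q)^-1 * `|dotv u (D i)|.
  rewrite dotvZl normrM gtr0_norm ?invr_gt0 //; congr (_ * `|_|).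
  by rewrite /dotv wt -mulmxA (mulmxA (invmx M)) mulVmx // mul1mx.
have : ((n%:R^-1 * \sum_(i < n) `|dotv v (M *m D i)|)%:E <= rho%:E)%E.
  by apply: le_trans sup_le; apply: ereal_sup_ubound; exists v.
rewrite lee_fin; under eq_bigr do rewrite dv.
by rewrite -mulr_sumr ler_pdivrMl ?ltr0n // mulrC ler_pdivrMr.
Qed.

End Stability.

(** * Assembling the stable set close to [T] *)

Lemma exists_stable_core (R : realType) (d : nat) (eps rho gamma : R)
    (Sigma : 'M[R]_d) (S0 S T : {mset 'cV[R]_d}) :
  0 < eps < 1 / 4 -> 0 < rho -> 1 <= eps * (size S0)%:R -> posdef Sigma ->
  pca_stable S0 eps gamma Sigma -> strong_perturbations S0 rho Sigma S ->
  outlier_corruptions S eps T ->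
  exists2 S' : {mset 'cV[R]_d},
    pca_stable S' (2 * eps) (100 * (gamma + rho ^+ 2 / eps)) Sigma &
    outlier_corruptions S' (2 * eps) T.
Proof.
move=> /andP[eps0 epsc] rho0 epsn Sp st [n [x [xt [M [S0E SE Minv sup_le]]]]].
have sizeE (f : 'I_n -> 'cV[R]_d) : size (seq_mset (codom f)) = n.
  by rewrite size_seq_mset size_codom card_ord.
rewrite {}S0E sizeE in epsn st *.
rewrite {}SE /outlier_corruptions /= sizeE => -[sT TS].
have n0 : (0 < n)%N.
  by rewrite lt0n; apply: contraTneq epsn => ->; rewrite mulr0 -ltNge.
have nR : 0 < n%:R :> R by rewrite ltr0n.
have [/andP[_ eg] _ _] := st.
pose D i := xt i - x i.
have absD := strong_sum_le Sigma M D rho n0 (ltW rho0) Sp Minv sup_le.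
have q0 := (posdef_psd Sigma Sp).2.
(* With [B = n * rho], this threshold turns [2 * B / tau] into [eps * n] discarded indices and
   [9 * tau * B] into [18 * n * rho ^+ 2 / eps]. *)
have tau0 : 0 < 2 * rho / eps by rewrite divr_gt0 // mulr_gt0.
have [G [Gc Gs]] :=
  sum_sqr_small_spread Sigma D (n%:R * rho) q0 (mulr_gt0 nR rho0) absD _ tau0.
have {}Gc : #|~: G|%:R <= eps * n%:R.
  rewrite -(ler_pM2r tau0); apply: le_trans Gc _.
  by rewrite le_eqVlt; apply/orP; left; apply/eqP; field; rewrite gt_eqF.
pose x' i := if i \in G then xt i else x i.
exists (seq_mset (codom x')); last first.
  rewrite sizeE; split=> //.
  have agree : {in G, xt =1 x'} by move=> i iG; rewrite /x' iG.
  have := size_msetI_agree xt x' G T agree.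
  rewrite -(ler_nat R) natrD => agreeR.
  have := le_trans TS agreeR; lra.
have r0 : 0 <= rho ^+ 2 / eps by rewrite divr_ge0 ?sqr_ge0 // ltW.
apply: sum_pca_stable => //.
- by apply/andP; split; lra.
- lra.
- exact: posdef_psd.
move=> J u Jn.
(* Zeroing [b] off [G] preserves the [l1] bound and leaves exactly the squares controlled by
   [Gs]. *)
pose b i := if i \in G then dotv u (D i) else 0.
have -> : \sum_(i in J) dotv u (x' i) ^+ 2 =
    \sum_(i in J) (dotv u (x i) + b i) ^+ 2.
  apply: eq_bigr => i _; congr (_ ^+ 2); rewrite /x' /b /D.
  by case: ifP => _; rewrite ?addr0 // -dotvDr addrC subrK.
have stu J' := pca_stable_sum x eps gamma Sigma st J' u.
apply: (perturbed_stable (fun i => dotv u (x i)) b eps gamma (rho ^+ 2 / eps)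
  (quad Sigma u) eps0 epsc eg epsn (q0 u) r0 stu rho) => //.
- apply: le_trans (absD u); apply: ler_sum => i _; rewrite /b.
  by case: ifP => _; rewrite ?normr0.
- have -> : \sum_i b i ^+ 2 = \sum_(i in G) dotv u (D i) ^+ 2.
    rewrite [RHS]big_mkcond /=; apply: eq_bigr => i _; rewrite /b.
    by case: ifP => _; rewrite ?expr0n.
  apply: le_trans (Gs u) _.
  by rewrite le_eqVlt; apply/orP; left; apply/eqP; field; rewrite gt_eqF.
Qed.

(* The stable set approximating T agrees with T on all but 2 * eps * n points:
   eps * n outliers, and up to eps * n points whose perturbation is too large.
   So 2 * eps is the contamination level passed to the algorithm.  If
   eps * n < 1 then (eps, gamma)-stability only constrains S0 itself, not its
   proper submultisets, and the claim fails; hence the bound 1 <= eps * n. *)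
Theorem theorem7p4 (R : realType) :
  exists c C : R, [/\ 0 < c, 0 < C &
    forall K : R, 0 < K -> exists2 K' : R, 0 < K' &
    forall (disp : measure_display) (Omega : measurableType disp)
      (P : probability Omega R) (A : randomized_pca R Omega)
      (delta : nat -> nat -> R -> R -> R),
    stability_based_pca P A K delta ->
    forall (d : nat) (eps rho gamma : R) (Sigma : 'M[R]_d)
      (S0 S T : {mset 'cV[R]_d}),
    (0 < d)%N ->
    0 < eps < c ->
    0 < rho < Num.sqrt eps ->
    1 <= eps * (size S0)%:R ->
    posdef Sigma ->
    pca_stable S0 eps gamma Sigma ->
    strong_perturbations S0 rho Sigma S ->
    outlier_corruptions S eps T ->
    let err := gamma + rho ^+ 2 / eps in
    let v := A d T (2 * eps) (C * err) in
    (forall w, unit_vec (v w)) /\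
    ((1 - delta d (size T) (2 * eps)%R (C * err)%R)%:E <=
       P [set w | ((1 - K' * err) * op_norm Sigma <= quad Sigma (v w))%R])%E].
Proof.
(* [eps < 1 / 4] keeps more than half of the points after losing [2 * eps * n]; 100 is the constant
   of [perturbed_stable], and it multiplies [K] in [K']. *)
exists (1 / 4), 100; split; [lra | lra | move=> K K0].
exists (K * 100); first by rewrite mulr_gt0.
move=> disp Omega P A delta stA d eps rho gamma Sigma S0 S T d0 epsc /andP[rho0 _].
move=> epsn Sp st pert TS err v.
have [S' st' TS'] := exists_stable_core R d eps rho gamma Sigma S0 S T
  epsc rho0 epsn Sp st pert TS.
have [vu vP] := stA d S' T (2 * eps) (100 * err) Sigma d0 st' TS'.
by split=> //; rewrite -(mulrA K).
Qed.
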